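(* Let Assumption (A1) hold and let $J:=\mathrm{tr}$ (the matrix trace). Then, at every point of $\mathcal D_F$, $$\boldsymbol\alpha^\ast=\frac{\sqrt{\mathrm{tr}\big(\boldsymbol K_1^{\boldsymbol\alpha^\ast}\hat P_1(\boldsymbol K_1^{\boldsymbol\alpha^\ast})^\top\big)}}{\sqrt{\mathrm{tr}\big(\boldsymbol K_1^{\boldsymbol\alpha^\ast}\hat P_1(\boldsymbol K_1^{\boldsymbol\alpha^\ast})^\top\big)}+\sqrt{\mathrm{tr}\big(\boldsymbol K_2^{\boldsymbol\alpha^\ast}\hat P_2(\boldsymbol K_2^{\boldsymbol\alpha^\ast})^\top\big)}}$$ for all solutions $\boldsymbol\alpha^\ast\colon\mathcal D_F\to[0,1]$ of problem (CI).
   Context: $n,p_1,p_2$ are positive integers, $p_1,p_2\le n$, $H_1\in\mathbb R^{p_1\times n}$, $H_2\in\mathbb R^{p_2\times n}$, $H=\begin{pmatrix}H_1\\H_2\end{pmatrix}$. Assumption (A1): $\mathrm{rk}(H_1)=p_1$, $\mathrm{rk}(H_2)=p_2$, $\mathrm{rk}(H)=n$ (and the two input estimators $\hat x_1,\hat x_2$ are unbiased estimators of $H_1x_{\rm true}$, $H_2x_{\rm true}$; in the deterministic maps only their values enter). $\mathcal S_m,\mathcal P_m,\mathcal P_m^\succ$: real symmetric, positive semi-definite, positive definite $m\times m$ matrices. $\mathcal D_F:=\mathbb R^{p_1}\times\mathbb R^{p_2}\times\mathcal P_{p_1}^\succ\times\mathcal P_{p_2}^\succ$, with points denoted $(\hat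 x_1,\hat x_2,\hat P_1,\hat P_2)$. For $J\colon\mathcal S_n\to\mathbb R$ let $\bar J\colon\mathcal S_n\cup\{+\infty\}\to\mathbb R\cup\{+\infty\}$ be given by $\bar J(+\infty)=+\infty$ and $\bar J=J$ on $\mathcal S_n$, and set $P^{-1}:=+\infty$ for singular $P\in\mathcal P_n$. Problem (CI): a solution is a function $\boldsymbol\alpha^\ast\colon\mathcal D_F\to[0,1]$ such that at every point of $\mathcal D_F$ and for every function $\boldsymbol\alpha\colon\mathcal D_F\to[0,1]$, $\bar J((\boldsymbol\alpha^\ast H_1^\top\hat P_1^{-1}H_1+(1-\boldsymbol\alpha^\ast)H_2^\top\hat P_2^{-1}H_2)^{-1})\le\bar J((\boldsymbol\alpha H_1^\top\hat P_1^{-1}H_1+(1-\boldsymbol\alpha)H_2^\top\hat P_2^{-1}H_2)^{-1})$. For $\boldsymbol\alpha\colon\mathcal D_F\to[0,1]$ (wherever the matrix being inverted is non-singular): $\hat{\boldsymbol P}^{\boldsymbol\alpha}:=(\boldsymbol\alpha H_1^\top\hat P_1^{-1}H_1+(1-\boldsymbol\alpha)H_2^\top\hat P_2^{-1}H_2)^{-1}$, $\boldsymbol K_1^{\boldsymbol\alpha}:=\boldsymbol\alpha\hat{\boldsymbol P}^{\boldsymbol\alpha}H_1^\top\hat P_1^{-1}$, $\boldsymbol K_2^{\boldsymbol\alpha}:=(1-\boldsymbol\alpha)\hat{\boldsymbol P}^{\boldsymbol\alpha}H_2^\top\hat P_2^{-1}$. *)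

(* Defs.v *)
(* Mathematical Components, with the real numbers and extended real numbers of
   MathComp-Analysis. *)
From HB Require Import structures.
From mathcomp Require Import all_boot all_order all_algebra.
From mathcomp Require Import reals constructive_ereal interval_inference.

Set Implicit Arguments.
Unset Strict Implicit.
Unset Printing Implicit Defensive.

Import Order.TTheory GRing.Theory Num.Theory.
Local Open Scope ring_scope.

Definition posdefmx (R : realType) (m : nat) (A : 'M[R]_m) : Prop :=
  A \is symmetricmx /\
  forall x : 'cV[R]_m, x != 0 -> 0 < (x^T *m A *m x) 0 0.

(* The points of D_F = R^p1 x R^p2 x P_p1^> x P_p2^>. *)
Record fusion_data (R : realType) (p1 p2 : nat) := FusionData {
  xhat1 : 'cV[R]_p1;
  xhat2 : 'cV[R]_p2;
  Phat1 : 'M[R]_p1;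
  Phat2 : 'M[R]_p2;
  Phat1_posdef : posdefmx Phat1;
  Phat2_posdef : posdefmx Phat2
}.

(* [None] stands for the element +oo adjoined to the symmetric matrices. *)
Definition ext_invmx (R : realType) (n : nat) (P : 'M[R]_n) : option 'M[R]_n :=
  if P \in unitmx then Some (invmx P) else None.

(* [J] is a total function on square matrices, but in [CI_solution] it is only
   ever evaluated at symmetric ones. *)
Definition ext_cost (R : realType) (n : nat) (J : 'M[R]_n -> R)
    (P : option 'M[R]_n) : \bar R :=
  if P is Some Q then (J Q)%:E else +oo%E.

Definition info_mx (R : realType) (n p1 p2 : nat)
    (H1 : 'M[R]_(p1, n)) (H2 : 'M[R]_(p2, n))
    (d : fusion_data R p1 p2) (a : R) : 'M[R]_n :=
  a *: (H1^T *m invmx (Phat1 d) *m H1)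
  + (1 - a) *: (H2^T *m invmx (Phat2 d) *m H2).

Definition CI_solution (R : realType) (n p1 p2 : nat)
    (H1 : 'M[R]_(p1, n)) (H2 : 'M[R]_(p2, n)) (J : 'M[R]_n -> R)
    (alphas : fusion_data R p1 p2 -> {i01 R}) : Prop :=
  forall (d : fusion_data R p1 p2) (alpha : fusion_data R p1 p2 -> {i01 R}),
    (ext_cost J (ext_invmx (info_mx H1 H2 d (alphas d)%:num))
     <= ext_cost J (ext_invmx (info_mx H1 H2 d (alpha d)%:num)))%E.

(* The fused covariance and the gains below are meaningful only where [info_mx]
   is in [unitmx], since [invmx] is the identity on singular matrices. *)
Definition fused_cov (R : realType) (n p1 p2 : nat)
    (H1 : 'M[R]_(p1, n)) (H2 : 'M[R]_(p2, n))
    (alpha : fusion_data R p1 p2 -> {i01 R})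
    (d : fusion_data R p1 p2) : 'M[R]_n :=
  invmx (info_mx H1 H2 d (alpha d)%:num).

Definition gain1 (R : realType) (n p1 p2 : nat)
    (H1 : 'M[R]_(p1, n)) (H2 : 'M[R]_(p2, n))
    (alpha : fusion_data R p1 p2 -> {i01 R})
    (d : fusion_data R p1 p2) : 'M[R]_(n, p1) :=
  (alpha d)%:num *: (fused_cov H1 H2 alpha d *m H1^T *m invmx (Phat1 d)).

Definition gain2 (R : realType) (n p1 p2 : nat)
    (H1 : 'M[R]_(p1, n)) (H2 : 'M[R]_(p2, n))
    (alpha : fusion_data R p1 p2 -> {i01 R})
    (d : fusion_data R p1 p2) : 'M[R]_(n, p2) :=
  (1 - (alpha d)%:num) *: (fused_cov H1 H2 alpha d *m H2^T *m invmx (Phat2 d)).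

(* Main.v *)
Require Import Defs.
From HB Require Import structures.
From mathcomp Require Import all_boot all_order all_algebra.
From mathcomp Require Import reals constructive_ereal interval_inference.
From mathcomp Require Import ring lra.

Set Implicit Arguments.
Unset Strict Implicit.
Unset Printing Implicit Defensive.

Import Order.TTheory GRing.Theory Num.Theory.
Local Open Scope ring_scope.

(** Write M(a) = a A1 + (1 - a) A2, where Ai = Hi^T Pi^-1 Hi is the information
    carried by the i-th estimate, and P = M(a)^-1 for the fused covariance at
    an optimal weight a.  Since H has full column rank, M(b) is positive
    definite for 0 < b < 1 ([info_mx_posdef]); the cost is therefore finite at
    b = 1/2, hence at the optimum, and M(a) is invertible.

    The gains satisfy tr (K1 P1 K1^T) = a^2 t1 and
    tr (K2 P2 K2^T) = (1 - a)^2 t2, where ti = tr (P Ai P) ([trace_gain]), and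
    t1, t2 > 0 because neither Hi vanishes ([trace_info_gt0]).  The claimed
    formula thus reads
      a = a sqrt t1 / (a sqrt t1 + (1 - a) sqrt t2),
    which holds trivially when a is 0 or 1.  When 0 < a < 1 it amounts to
    t1 = t2, that is, to the vanishing at a of the derivative
    - tr (P (A1 - A2) P) of b |-> tr (M(b)^-1).

    This first-order condition is [trace_invmx_stationary].  It is obtained
    without differential calculus from the exact second-order expansion
    [invmx_expansion] of (M + h D)^-1, whose quadratic remainder is controlled
    uniformly in h by the antitonicity of matrix inversion in the Loewner order
    ([invmx_antitone]): M + 2 h D >= 0 gives M + h D >= M / 2, and so
    (M + h D)^-1 <= 2 M^-1. *)

(** * Quadratic forms and positive definite matrices *)

Definition qform (R : realType) (m : nat) (A : 'M[R]_m) (x : 'cV[R]_m) : R :=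
  (x^T *m A *m x) 0 0.

Lemma qformD (R : realType) m (A B : 'M[R]_m) x :
  qform (A + B) x = qform A x + qform B x.
Proof. by rewrite /qform mulmxDr mulmxDl mxE. Qed.

Lemma qformZ (R : realType) m a (A : 'M[R]_m) x :
  qform (a *: A) x = a * qform A x.
Proof. by rewrite /qform -scalemxAr -scalemxAl mxE. Qed.

Lemma qform0 (R : realType) m (A : 'M[R]_m) : qform A 0 = 0.
Proof. by rewrite /qform mulmx0 mxE. Qed.

Lemma qform_congr (R : realType) m n (A : 'M[R]_m) (B : 'M[R]_(m, n)) x :
  qform (B^T *m A *m B) x = qform A (B *m x).
Proof. by rewrite /qform trmx_mul !mulmxA. Qed.

Lemma symmetricmxE (R : realType) m (A : 'M[R]_m) :
  (A \is symmetricmx) = (A^T == A).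
Proof. by rewrite qualifE /= expr0 scale1r map_mx_id // eq_sym. Qed.

Lemma posdefmx_tr (R : realType) m (A : 'M[R]_m) : posdefmx A -> A^T = A.
Proof. by case; rewrite symmetricmxE => /eqP. Qed.

Lemma posdefmx_gt0 (R : realType) m (A : 'M[R]_m) x :
  posdefmx A -> x != 0 -> 0 < qform A x.
Proof. by case=> _; apply. Qed.

Lemma posdefmx_ge0 (R : realType) m (A : 'M[R]_m) x :
  posdefmx A -> 0 <= qform A x.
Proof.
move=> pA; have [->|x0] := eqVneq x 0; first by rewrite qform0.
exact/ltW/posdefmx_gt0.
Qed.

Lemma posdefmxZ (R : realType) m a (A : 'M[R]_m) :
  0 < a -> posdefmx A -> posdefmx (a *: A).
Proof.
move=> a0 pA; split; first by rewrite symmetricmxE linearZ /= posdefmx_tr.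
by move=> x x0; rewrite -/(qform _ _) qformZ mulr_gt0 // posdefmx_gt0.
Qed.

Lemma posdefmx_unit (R : realType) m (A : 'M[R]_m) :
  posdefmx A -> A \in unitmx.
Proof.
move=> pA; rewrite -row_free_unit -kermx_eq0; apply/eqP/row_matrixP => i.
rewrite row0; apply/eqP/negPn/negP => u0.
have uA : row i (kermx A) *m A = 0 by apply/sub_kermxP; exact: row_sub.
have : 0 < qform A (row i (kermx A))^T.
  by apply: posdefmx_gt0 => //; rewrite -trmx0 (inj_eq trmx_inj).
by rewrite /qform trmxK uA mul0mx mxE ltxx.
Qed.

Lemma invmx_sym (R : realType) m (A : 'M[R]_m) :
  A^T = A -> (invmx A)^T = invmx A.
Proof. by move=> sA; rewrite trmx_inv sA. Qed.

Lemma qform_invmx (R : realType) m (A : 'M[R]_m) x :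
  A \in unitmx -> A^T = A -> qform (invmx A) x = qform A (invmx A *m x).
Proof.
by move=> uA sA; rewrite -qform_congr invmx_sym // mulVmx // mul1mx.
Qed.

Lemma posdefmx_inv (R : realType) m (A : 'M[R]_m) :
  posdefmx A -> posdefmx (invmx A).
Proof.
move=> pA; have uA := posdefmx_unit pA; have sA := posdefmx_tr pA.
split; first by rewrite symmetricmxE invmx_sym.
move=> x x0; rewrite -/(qform _ _) qform_invmx //; apply: posdefmx_gt0 => //.
by apply: contraNneq x0 => /(congr1 (mulmx A)); rewrite mulKVmx // mulmx0 => ->.
Qed.

(** With y = N^-1 v and x = M^-1 v, expanding 0 <= (y - x)^T M (y - x) gives
    2 y^T v <= y^T M y + x^T v, and y^T M y <= y^T N y = y^T v. *)
Lemma invmx_antitone (R : realType) m (M N : 'M[R]_m) :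
  posdefmx M -> posdefmx N -> (forall x, qform M x <= qform N x) ->
  forall v, qform (invmx N) v <= qform (invmx M) v.
Proof.
move=> pM pN leMN v.
have [uM uN] := (posdefmx_unit pM, posdefmx_unit pN).
have [sM sN] := (posdefmx_tr pM, posdefmx_tr pN).
set y := invmx N *m v; set x := invmx M *m v.
have Mx : M *m x = v by rewrite mulKVmx.
have yv : (y^T *m v) 0 0 = qform (invmx N) v.
  by rewrite /qform /y trmx_mul invmx_sym.
have xv : (x^T *m v) 0 0 = qform (invmx M) v.
  by rewrite /qform /x trmx_mul invmx_sym.
have xMy : (x^T *m (M *m y)) 0 0 = qform (invmx N) v.
  rewrite -yv mulmxA -[in LHS]sM -trmx_mul Mx.
  by rewrite -[in LHS](trmxK y) -trmx_mul [LHS]mxE.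
have entryB (A B : 'M[R]_1) : (A - B) 0 0 = A 0 0 - B 0 0 by rewrite !mxE.
have expand : qform M (y - x) =
    qform M y - qform (invmx N) v *+ 2 + qform (invmx M) v.
  rewrite {1}/qform [(y - x)^T]linearB /= -mulmxA mulmxBr Mx.
  rewrite mulmxBl !mulmxBr !entryB xMy yv xv mulmxA -/(qform M y); ring.
have := posdefmx_ge0 (y - x) pM; rewrite expand.
have := leMN y; rewrite /y -[qform N _]qform_invmx // -/y; lra.
Qed.

(** * Traces of congruences *)

Lemma trace_congr (R : realType) m n (A : 'M[R]_m) (B : 'M[R]_(n, m)) :
  \tr (B *m A *m B^T) = \sum_i qform A (row i B)^T.
Proof.
apply: eq_bigr => i _.
rewrite /qform trmxK -row_mul !mxE.
by apply: eq_bigr => j _; rewrite !mxE.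
Qed.

Lemma trace_congr_le (R : realType) m n (A A' : 'M[R]_m) (B : 'M[R]_(n, m)) :
  (forall x, qform A x <= qform A' x) ->
  \tr (B *m A *m B^T) <= \tr (B *m A' *m B^T).
Proof. by move=> leA; rewrite !trace_congr; apply: ler_sum => i _. Qed.

Lemma trace_congr_gt0 (R : realType) m n (A : 'M[R]_m) (B : 'M[R]_(n, m)) :
  posdefmx A -> B != 0 -> 0 < \tr (B *m A *m B^T).
Proof.
move=> pA B0; rewrite trace_congr.
have [i Bi0] : exists i, row i B != 0.
  apply/existsP; apply: contraNT B0 => /existsPn Bi.
  apply/eqP/row_matrixP => i; rewrite row0; apply/eqP/negPn; exact: Bi.
rewrite (bigD1 i) //= ltr_pwDl ?sumr_ge0 // => [|j _]; last exact: posdefmx_ge0.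
by apply: posdefmx_gt0 => //; rewrite -trmx0 (inj_eq trmx_inj).
Qed.

(** * First-order condition for the trace of an inverse *)

(** The Neumann series of (M + h D)^-1 stopped at second order, exact because
    its remainder keeps one factor (M + h D)^-1.  It comes from inserting one
    form of the resolvent identity into the other. *)
Lemma invmx_expansion (R : realType) m (M D : 'M[R]_m) h :
  M \in unitmx -> M + h *: D \in unitmx ->
  invmx (M + h *: D) = invmx M - h *: (invmx M *m D *m invmx M)
    + h ^+ 2 *: (invmx M *m D *m invmx (M + h *: D) *m D *m invmx M).
Proof.
move=> uM uN; set N := M + h *: D in uN *; set P := invmx M; set Q := invmx N.
have resolvent_l : Q = P - h *: (Q *m D *m P).
  have : Q *m N *m P = P by rewrite mulVmx // mul1mx.
  rewrite /N mulmxDr mulmxDl mulmxK // -scalemxAr -scalemxAl.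
  exact: (canRL (addrK _)).
have resolvent_r : Q = P - h *: (P *m D *m Q).
  have : P *m (N *m Q) = P by rewrite mulmxV // mulmx1.
  rewrite /N mulmxDl mulmxDr mulKmx // -scalemxAl -scalemxAr mulmxA.
  exact: (canRL (addrK _)).
rewrite [LHS]resolvent_r [in LHS]resolvent_l mulmxBr -scalemxAr scalerBr.
by rewrite scalerA -expr2 opprB addrA addrAC !mulmxA.
Qed.

Lemma linear_coef_eq0 (R : realType) (e T C : R) :
  0 < e -> (forall h, `|h| <= e -> h * T <= h ^+ 2 * C) -> T = 0.
Proof.
move=> e0 le_hT; apply/eqP/negPn/negP => T0.
pose C1 := `|C| + 1; have C1_gt0 : 0 < C1 by rewrite ltr_wpDl.
pose k := `|T| + e * C1.
have k_gt0 : 0 < k by rewrite ltr_wpDl // mulr_gt0.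
(* The step h = T e / k satisfies |h| <= e because |T| <= k, and
   h ^+ 2 * C < h * T because e C < k. *)
have /le_hT : `|T * (e / k)| <= e.
  rewrite normrM [ `|e / k|]gtr0_norm ?divr_gt0 // mulrA ler_pdivrMr //.
  by rewrite mulrC ler_pM2l // lerDl mulr_ge0 ?ltW.
apply/negP; rewrite -ltNge.
have -> : T * (e / k) * T = T ^+ 2 * (e / k) by ring.
have -> : (T * (e / k)) ^+ 2 * C = T ^+ 2 * (e / k) * (e / k * C) by ring.
rewrite -[ltRHS]mulr1 ltr_pM2l; last first.
  by rewrite mulr_gt0 ?divr_gt0 // exprn_even_gt0.
rewrite mulrAC ltr_pdivrMr // mul1r /k ltr_wpDl // ltr_pM2l // /C1.
by rewrite (le_lt_trans (ler_norm C)) // ltrDl.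
Qed.

(** If M + h D stays positive semidefinite on [-e, e], then on the half as long
    interval M + h D = M / 2 + (M + 2 h D) / 2 dominates M / 2, which bounds
    the second-order term of the expansion independently of h. *)
Lemma trace_invmx_stationary (R : realType) m (M D : 'M[R]_m) e :
  posdefmx M -> D^T = D -> 0 < e ->
  (forall h x, `|h| <= e -> 0 <= qform (M + h *: D) x) ->
  (forall h, `|h| <= e -> \tr (invmx M) <= \tr (invmx (M + h *: D))) ->
  \tr (invmx M *m D *m invmx M) = 0.
Proof.
move=> pM sD e0 psd minM; set P := invmx M.
have uM := posdefmx_unit pM; have sM := posdefmx_tr pM.
have sP : P^T = P by rewrite invmx_sym.
pose C := \tr (P *m D *m (2 *: P) *m (P *m D)^T).
have e2_gt0 : 0 < e / 2 by rewrite divr_gt0.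
apply: (linear_coef_eq0 (C := C) e2_gt0) => h leh.
have le_half x : qform (2^-1 *: M) x <= qform (M + h *: D) x.
  have : 0 <= qform (M + (2 * h) *: D) x.
    by apply: psd; rewrite normrM ger0_norm // mulrC -ler_pdivlMr.
  rewrite !qformD !qformZ; lra.
have pM2 : posdefmx (2^-1 *: M) by apply: posdefmxZ.
have pN : posdefmx (M + h *: D).
  split; first by rewrite symmetricmxE linearD linearZ /= sM sD.
  by move=> x x0; apply: lt_le_trans (le_half x); exact: posdefmx_gt0.
have uN := posdefmx_unit pN.
have leC : \tr (P *m D *m invmx (M + h *: D) *m (P *m D)^T) <= C.
  apply: trace_congr_le => x.
  have := invmx_antitone pM2 pN le_half x.
  by rewrite invmxZ ?posdefmx_unit // invrK.
have leh_e : `|h| <= e by apply: le_trans leh _; lra.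
have := minM h leh_e; rewrite (invmx_expansion uM uN) -/P.
move: leC; rewrite trmx_mul sD sP !mulmxA => leC.
rewrite !(linearD, linearN, linearZ) /=.
have := ler_wpM2l (sqr_ge0 h) leC; lra.
Qed.

(** * Covariance intersection *)

Lemma info_mx_sym (R : realType) (n p1 p2 : nat) (H1 : 'M[R]_(p1, n))
    (H2 : 'M[R]_(p2, n)) (d : fusion_data R p1 p2) a :
  (info_mx H1 H2 d a)^T = info_mx H1 H2 d a.
Proof.
have s1 := posdefmx_tr (posdefmx_inv (Phat1_posdef d)).
have s2 := posdefmx_tr (posdefmx_inv (Phat2_posdef d)).
by rewrite /info_mx linearD !linearZ /= !trmx_mul !trmxK s1 s2 !mulmxA.
Qed.

Lemma qform_info (R : realType) (n p1 p2 : nat) (H1 : 'M[R]_(p1, n))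
    (H2 : 'M[R]_(p2, n)) (d : fusion_data R p1 p2) a x :
  qform (info_mx H1 H2 d a) x =
  a * qform (invmx (Phat1 d)) (H1 *m x)
  + (1 - a) * qform (invmx (Phat2 d)) (H2 *m x).
Proof. by rewrite qformD !qformZ !qform_congr. Qed.

Lemma info_mx_psd (R : realType) (n p1 p2 : nat) (H1 : 'M[R]_(p1, n))
    (H2 : 'M[R]_(p2, n)) (d : fusion_data R p1 p2) a x :
  0 <= a <= 1 -> 0 <= qform (info_mx H1 H2 d a) x.
Proof.
case/andP=> a0 a1; rewrite qform_info.
have q1 := posdefmx_inv (Phat1_posdef d).
have q2 := posdefmx_inv (Phat2_posdef d).
by rewrite addr_ge0 // mulr_ge0 ?subr_ge0 ?posdefmx_ge0.
Qed.

(** The form vanishes at x only if H1 x = H2 x = 0, and then x = 0 because the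
    stacked matrix has a left inverse. *)
Lemma info_mx_posdef (R : realType) (n p1 p2 : nat) (H1 : 'M[R]_(p1, n))
    (H2 : 'M[R]_(p2, n)) (d : fusion_data R p1 p2) a :
  \rank (col_mx H1 H2) = n -> 0 < a < 1 -> posdefmx (info_mx H1 H2 d a).
Proof.
move=> rkH /andP[a0 a1]; split; first by rewrite symmetricmxE info_mx_sym.
move=> x x0; rewrite -/(qform _ _) qform_info.
have q1 := posdefmx_inv (Phat1_posdef d).
have q2 := posdefmx_inv (Phat2_posdef d).
have b0 : 0 < 1 - a by rewrite subr_gt0.
have [Hx1|Hx1] := eqVneq (H1 *m x) 0; last first.
  by rewrite ltr_pwDl ?mulr_gt0 ?posdefmx_gt0 // mulr_ge0 ?posdefmx_ge0 // ltW.
have [Hx2|Hx2] := eqVneq (H2 *m x) 0; last first.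
  by rewrite ltr_wpDl ?mulr_gt0 ?posdefmx_gt0 // mulr_ge0 ?posdefmx_ge0 // ltW.
have /row_fullP[B BH] : row_full (col_mx H1 H2) by rewrite /row_full rkH.
move: x0; rewrite -[x]mul1mx -BH -mulmxA mul_col_mx Hx1 Hx2.
by rewrite col_mx0 mulmx0 eqxx.
Qed.

(** The trace is that of the congruence of S^-1 by P H^T, which is nonzero as P
    is invertible and H has positive rank. *)
Lemma trace_info_gt0 (R : realType) (n p : nat) (P : 'M[R]_n)
    (H : 'M[R]_(p, n)) (S : 'M[R]_p) :
  P \in unitmx -> P^T = P -> (0 < p)%N -> \rank H = p -> posdefmx S ->
  0 < \tr (P *m (H^T *m invmx S *m H) *m P).
Proof.
move=> uP sP p0 rkH pS.
have -> : P *m (H^T *m invmx S *m H) *m P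
        = (P *m H^T) *m invmx S *m (P *m H^T)^T.
  by rewrite trmx_mul trmxK sP !mulmxA.
apply: trace_congr_gt0; first exact: posdefmx_inv.
apply: contraTneq p0 => /(congr1 (mulmx (invmx P))).
rewrite mulKmx // mulmx0 => /(congr1 trmx); rewrite trmxK trmx0 => H0.
by rewrite -rkH H0 mxrank0.
Qed.

Lemma trace_gain (R : realType) (n p : nat) (P : 'M[R]_n)
    (H : 'M[R]_(p, n)) (S : 'M[R]_p) a :
  P^T = P -> posdefmx S ->
  let K := a *: (P *m H^T *m invmx S) in
  \tr (K *m S *m K^T) = a ^+ 2 * \tr (P *m (H^T *m invmx S *m H) *m P).
Proof.
move=> sP pS /=; have uS := posdefmx_unit pS.
have sS := invmx_sym (posdefmx_tr pS).
rewrite linearZ /= -!scalemxAl -scalemxAr scalerA -expr2 linearZ /=.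
by rewrite mulmxKV // !trmx_mul trmxK sS sP !mulmxA.
Qed.

Theorem theorem34 (R : realType) (n p1 p2 : nat)
    (n_gt0 : (0 < n)%N) (p1_gt0 : (0 < p1)%N) (p2_gt0 : (0 < p2)%N)
    (le_p1_n : (p1 <= n)%N) (le_p2_n : (p2 <= n)%N)
    (H1 : 'M[R]_(p1, n)) (H2 : 'M[R]_(p2, n))
    (rkH1 : \rank H1 = p1) (rkH2 : \rank H2 = p2)
    (rkH : \rank (col_mx H1 H2) = n)
    (alphas : fusion_data R p1 p2 -> {i01 R})
    (solves : CI_solution H1 H2 (fun P : 'M[R]_n => \tr P) alphas)
    (d : fusion_data R p1 p2) :
  let K1 := gain1 H1 H2 alphas d in
  let K2 := gain2 H1 H2 alphas d in
  let s1 := Num.sqrt (\tr (K1 *m Phat1 d *m K1^T)) in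
  let s2 := Num.sqrt (\tr (K2 *m Phat2 d *m K2^T)) in
  [/\ info_mx H1 H2 d (alphas d)%:num \in unitmx,
      s1 + s2 != 0
    & (alphas d)%:num = s1 / (s1 + s2)].
Proof.
move=> K1 K2 s1 s2; set a : R := (alphas d)%:num.
have [a_ge0 a_le1] : 0 <= a /\ a <= 1 by rewrite /a; split.
pose M b := info_mx H1 H2 d b; pose P := invmx (M a).
(* Only constant competitors are needed: the cost at d sees the value at d. *)
have opt b : 0 <= b <= 1 ->
    (ext_cost (fun Q : 'M[R]_n => \tr Q) (ext_invmx (M a))
     <= ext_cost (fun Q : 'M[R]_n => \tr Q) (ext_invmx (M b)))%E.
  case/andP=> b0 b1; exact: (solves d (fun=> Itv01 b0 b1)).
have uMb b : 0 < b < 1 -> M b \in unitmx.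
  by move=> b01; apply/posdefmx_unit/info_mx_posdef.
have uM : M a \in unitmx.
  (* At 1/2 the cost is finite, so it cannot be +oo at the optimum. *)
  have half : 0 < (2^-1 : R) < 1 by lra.
  have : 0 <= (2^-1 : R) <= 1 by lra.
  move=> /opt; rewrite /ext_invmx (uMb _ half) /=.
  by case: ifP => //= _; rewrite leye_eq.
have sP : P^T = P by rewrite invmx_sym ?info_mx_sym.
have uP : P \in unitmx by rewrite unitmx_inv.
pose A1 := H1^T *m invmx (Phat1 d) *m H1.
pose A2 := H2^T *m invmx (Phat2 d) *m H2.
pose t1 := \tr (P *m A1 *m P); pose t2 := \tr (P *m A2 *m P).
have t1_gt0 : 0 < t1 by exact: trace_info_gt0 (Phat1_posdef d).
have t2_gt0 : 0 < t2 by exact: trace_info_gt0 (Phat2_posdef d).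
have s1E : s1 = a * Num.sqrt t1.
  rewrite /s1 /K1 (trace_gain _ _ sP (Phat1_posdef d)) sqrtrM ?sqr_ge0 //.
  by rewrite sqrtr_sqr ger0_norm.
have s2E : s2 = (1 - a) * Num.sqrt t2.
  rewrite /s2 /K2 (trace_gain _ _ sP (Phat2_posdef d)) sqrtrM ?sqr_ge0 //.
  by rewrite sqrtr_sqr ger0_norm // subr_ge0.
have r1_gt0 : 0 < Num.sqrt t1 by rewrite sqrtr_gt0.
have r2_gt0 : 0 < Num.sqrt t2 by rewrite sqrtr_gt0.
suff [] : s1 + s2 != 0 /\ a = s1 / (s1 + s2) by split.
have [a0|a_neq0] := eqVneq a 0.
  by rewrite s1E s2E a0 !mul0r subr0 mul1r add0r gt_eqF.
have [a1|a_neq1] := eqVneq a 1.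
  by rewrite s1E s2E a1 subrr mul0r mul1r addr0 gt_eqF // divff // gt_eqF.
have a_gt0 : 0 < a by rewrite lt_def a_neq0.
have a_lt1 : a < 1 by rewrite lt_neqAle a_neq1.
have t12 : t1 = t2.
  (* The factor 1/2 keeps [a - e, a + e] inside the open unit interval, where
     every M b is positive definite. *)
  pose e := Num.min a (1 - a) / 2.
  have e_gt0 : 0 < e by rewrite divr_gt0 // lt_min a_gt0 subr_gt0.
  have shift h : M a + h *: (A1 - A2) = M (a + h).
    rewrite /M /info_mx -/A1 -/A2 opprD addrA scalerBr !scalerDl !scaleNr.
    by rewrite addrACA.
  have inside h : `|h| <= e -> 0 < a + h < 1.
    rewrite ler_norml => /andP[h1 h2].
    have : e <= a / 2 by rewrite ler_pM2r ?invr_gt0 // ge_min lexx.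
    have : e <= (1 - a) / 2 by rewrite ler_pM2r ?invr_gt0 // ge_min lexx orbT.
    by move=> ? ?; apply/andP; split; lra.
  have sD : (A1 - A2)^T = A1 - A2.
    have q1 := posdefmx_tr (posdefmx_inv (Phat1_posdef d)).
    have q2 := posdefmx_tr (posdefmx_inv (Phat2_posdef d)).
    by rewrite linearB /= !trmx_mul !trmxK q1 q2 !mulmxA.
  have pM : posdefmx (M a) by apply: info_mx_posdef => //; rewrite a_gt0.
  apply/eqP; rewrite -subr_eq0 -linearB /= -mulmxBl -mulmxBr; apply/eqP.
  apply: (trace_invmx_stationary pM sD e_gt0) => [h x /inside|h /inside].
    by rewrite shift => /andP[/ltW ? /ltW ?]; apply: info_mx_psd; apply/andP.
  rewrite shift => ah; have uMh := uMb _ ah; case/andP: ah => /ltW ah0 /ltW ah1.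
  by have := opt (a + h); rewrite ah0 ah1 /ext_invmx uM uMh /= lee_fin; apply.
have s12 : s1 + s2 = Num.sqrt t1 by rewrite s1E s2E -t12; ring.
by rewrite s12 gt_eqF // s1E mulfK // gt_eqF.
Qed.
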